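(* Let $\mathbb{F} \in \{\mathbb{R},\mathbb{C},\mathbb{H}\}$ and let $k \geqslant 1$ be an integer. Let $\mathcal{S}'_k(\mathbb{F}) \subset \mathcal{S}_k(\mathbb{F})$ denote the set of equivalence classes of the norms $\{ \|\cdot\|_p : 1 \leqslant p \leqslant \infty \}$ on $\mathbb{F}^k$. Then the map $f : \mathcal{S}'_k(\mathbb{F}) \to [0,\log k]$ given by $f(\|\cdot\|_p) = \frac{\log k}{p}$ for $p \in [1,\infty)$ and $f(\|\cdot\|_\infty) = 0$ is an isometric bijection (where $[0,\log k]$ has the usual metric of $\mathbb{R}$).
   Context: $\mathbb{F}$ is the real numbers, the complex numbers or the quaternions; $|\alpha| = \sqrt{\alpha\alpha^*}$ is the usual absolute value on $\mathbb{F}$, where $\alpha^*$ is the usual conjugate. A norm on $\mathbb{F}^k$ is a function $N : \mathbb{F}^k \to \mathbb{R}$ such that for all $\mathbf{x},\mathbf{y} \in \mathbb{F}^k$ and $\alpha \in \mathbb{F}$: $N(\mathbf{x}) \geqslant 0$ with equality if and only if $\mathbf{x}=0$; $N(\alpha \mathbf{x}) = |\alpha| N(\mathbf{x})$; and $N(\mathbf{x}+\mathbf{y}) \leqslant N(\mathbf{x}) + N(\mathbf{y})$. Two norms $N,N'$ are equivalent, $N \sim N'$, if $N' = \alpha N$ for some real $\alpha>0$; $\mathcal{S}_k(\mathbb{F})$ is the set of equivalence classes of norms on $\mathbb{F}^k$, with the metric $$d_{\mathcal{S}_k(\mathbb{F})}([N],[N']) = \log \sup_{\mathbf{x} \neq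 0} \frac{N'(\mathbf{x})}{N(\mathbf{x})} - \log \inf_{\mathbf{x}\neq 0} \frac{N'(\mathbf{x})}{N(\mathbf{x})}.$$ For $p \in [1,\infty)$ and $\mathbf{x} = (x_1,\dots,x_k) \in \mathbb{F}^k$, $\|\mathbf{x}\|_p = (|x_1|^p + \cdots + |x_k|^p)^{1/p}$, and $\|\mathbf{x}\|_\infty = \max_j |x_j|$. *)

(* Defs.v *)
From HB Require Import structures.
From mathcomp Require Import all_boot all_order all_algebra.
From mathcomp Require Import generic_quotient complex ring lra.
From mathcomp Require Import all_classical all_reals all_analysis.

Set Implicit Arguments.
Unset Strict Implicit.
Unset Printing Implicit Defensive.

Import Order.TTheory GRing.Theory Num.Theory.

Local Open Scope classical_set_scope.
Local Open Scope ring_scope.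

Record quaternion (R : Type) := Quaternion {
  quat_re : R; quat_i : R; quat_j : R; quat_k : R }.

Section QuaternionRing.
Variable R : realType.
Local Notation H := (quaternion R).

Definition quat_to_prod (x : H) :=
  let: Quaternion a b c d := x in (a, b, c, d).
Definition quat_of_prod (u : R * R * R * R) : H :=
  let: (a, b, c, d) := u in Quaternion a b c d.

Lemma quat_to_prodK : cancel quat_to_prod quat_of_prod.
Proof. by case. Qed.

HB.instance Definition _ := Choice.copy H (can_type quat_to_prodK).

Definition quat_add (x y : H) : H :=
  let: Quaternion a b c d := x in let: Quaternion e f g h := y in
  Quaternion (a + e) (b + f) (c + g) (d + h).
Definition quat_opp (x : H) : H :=
  let: Quaternion a b c d := x in Quaternion (- a) (- b) (- c) (- d).
Definition quat_mul (x y : H) : H :=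
  let: Quaternion a b c d := x in let: Quaternion e f g h := y in
  Quaternion (a * e - b * f - c * g - d * h)
             (a * f + b * e + c * h - d * g)
             (a * g - b * h + c * e + d * f)
             (a * h + b * g - c * f + d * e).

Fact quat_addA : associative quat_add.
Proof. by move=> [????] [????] [????] /=; rewrite !addrA. Qed.
Fact quat_addC : commutative quat_add.
Proof. by move=> [a b c d] [e f g h] /=; congr Quaternion; rewrite addrC. Qed.
Fact quat_add0 : left_id (Quaternion 0 0 0 0) quat_add.
Proof. by move=> [????] /=; rewrite !add0r. Qed.
Fact quat_addN : left_inverse (Quaternion 0 0 0 0) quat_opp quat_add.
Proof. by move=> [????] /=; rewrite !addNr. Qed.

HB.instance Definition _ :=
  GRing.isZmodule.Build H quat_addA quat_addC quat_add0 quat_addN.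

Fact quat_mulA : associative quat_mul.
Proof. by move=> [????] [????] [????] /=; congr Quaternion; ring. Qed.
Fact quat_mul1 : left_id (Quaternion 1 0 0 0) quat_mul.
Proof. by move=> [????] /=; congr Quaternion; ring. Qed.
Fact quat_mulr1 : right_id (Quaternion 1 0 0 0) quat_mul.
Proof. by move=> [????] /=; congr Quaternion; ring. Qed.
Fact quat_mulDl : left_distributive quat_mul +%R.
Proof. by move=> [????] [????] [????]; congr Quaternion; ring. Qed.
Fact quat_mulDr : right_distributive quat_mul +%R.
Proof. by move=> [????] [????] [????]; congr Quaternion; ring. Qed.
Fact quat_1neq0 : Quaternion 1 0 0 0 != 0 :> H.
Proof. by apply/eqP => -[] /eqP; rewrite oner_eq0. Qed.

HB.instance Definition _ := GRing.Zmodule_isNzRing.Build H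
  quat_mulA quat_mul1 quat_mulr1 quat_mulDl quat_mulDr quat_1neq0.

Definition quat_conj (x : H) : H :=
  let: Quaternion a b c d := x in Quaternion a (- b) (- c) (- d).

End QuaternionRing.

Inductive scalar_kind := Reals | Complexes | Quaternions.

Section Scalars.
Variable R : realType.

Definition scalar (F : scalar_kind) : nzRingType :=
  match F with
  | Reals => R
  | Complexes => complex R
  | Quaternions => quaternion R
  end.

Definition scalar_conj (F : scalar_kind) : scalar F -> scalar F :=
  match F return scalar F -> scalar F with
  | Reals => id
  | Complexes => @conjc R
  | Quaternions => @quat_conj R
  end.

Definition scalar_re (F : scalar_kind) : scalar F -> R :=
  match F return scalar F -> R with
  | Reals => id
  | Complexes => @complex.Re R
  | Quaternions => @quat_re R
  end.

(* [a * scalar_conj a] is real; [scalar_re] only views it as an element of [R]. *)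
Definition scalar_abs (F : scalar_kind) (a : scalar F) : R :=
  Num.sqrt (scalar_re (a * scalar_conj a)).

Definition to_quat (F : scalar_kind) : scalar F -> quaternion R :=
  match F return scalar F -> quaternion R with
  | Reals => fun a : R => Quaternion a 0 0 0
  | Complexes => fun z : complex R => Quaternion (complex.Re z) (complex.Im z) 0 0
  | Quaternions => id
  end.

Definition sqr_quat (x : quaternion R) : R :=
  let: Quaternion a b c d := x in a ^+ 2 + b ^+ 2 + c ^+ 2 + d ^+ 2.

Lemma absE F (a : scalar F) : scalar_abs a = Num.sqrt (sqr_quat (to_quat a)).
Proof.
rewrite /scalar_abs; congr Num.sqrt.
by case: F a => [a|[a b]|[a b c d]] /=; ring.
Qed.

Lemma abs_real (a : scalar Reals) : scalar_abs a = `|a : R|.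
Proof. by rewrite /scalar_abs /= -expr2 sqrtr_sqr. Qed.

Lemma abs_complex (z : scalar Complexes) :
  real_complex R (scalar_abs z) = `|z : complex R|.
Proof. by rewrite absE normc_def /= !expr0n /= !addr0. Qed.

Lemma to_quatD F (a b : scalar F) : to_quat (a + b) = to_quat a + to_quat b.
Proof.
case: F a b => [a b|[a b] [c d]|//] /=.
  by rewrite /GRing.add /= !addr0.
by rewrite [RHS]/GRing.add /= !addr0.
Qed.

Lemma to_quatM F (a b : scalar F) : to_quat (a * b) = to_quat a * to_quat b.
Proof.
case: F a b => [a b|[a b] [c d]|//] /=.
  by rewrite [RHS]/GRing.mul /=; congr Quaternion; ring.
by rewrite [RHS]/GRing.mul /=; congr Quaternion; ring.
Qed.

Lemma sqr_quat_ge0 x : 0 <= sqr_quat x.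
Proof. by case: x => a b c d /=; rewrite !addr_ge0 ?sqr_ge0. Qed.

Lemma abs_ge0 F (a : scalar F) : 0 <= scalar_abs a.
Proof. exact: sqrtr_ge0. Qed.

Lemma abs0 F : scalar_abs (0 : scalar F) = 0.
Proof. by rewrite absE; case: F => /=; rewrite !expr0n /= !addr0 sqrtr0. Qed.

Lemma abs_eq0 F (a : scalar F) : scalar_abs a = 0 -> a = 0.
Proof.
rewrite absE => /eqP; rewrite sqrtr_eq0 => h.
have {h} : sqr_quat (to_quat a) = 0.
  by apply/eqP; rewrite eq_le h sqr_quat_ge0.
have sq (x y z t : R) : x ^+ 2 + y ^+ 2 + z ^+ 2 + t ^+ 2 = 0 ->
    [/\ x = 0, y = 0, z = 0 & t = 0].
  move=> /eqP; rewrite !paddr_eq0 ?addr_ge0 ?sqr_ge0// !sqrf_eq0.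
  by move=> /andP[/andP[/andP[/eqP-> /eqP->] /eqP->] /eqP->].
by case: F a => [a|[a b]|[a b c d]] /sq[] /=; [move=> ->|move=> -> ->|move=> -> -> -> ->].
Qed.

Lemma absM F (a b : scalar F) : scalar_abs (a * b) = scalar_abs a * scalar_abs b.
Proof.
rewrite !absE to_quatM -sqrtrM ?sqr_quat_ge0//; congr Num.sqrt.
by case: (to_quat a) (to_quat b) => [????] [????] /=; ring.
Qed.

Lemma abs_triangle F (a b : scalar F) : scalar_abs (a + b) <= scalar_abs a + scalar_abs b.
Proof.
rewrite !absE to_quatD; move: (to_quat a) (to_quat b) => x y.
rewrite -(ler_pXn2r (ltn0Sn 1)) ?nnegrE ?addr_ge0 ?sqrtr_ge0//.
rewrite sqrrD !sqr_sqrtr ?sqr_quat_ge0// -sqrtrM ?sqr_quat_ge0//.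
case: x y => [a0 a1 a2 a3] [b0 b1 b2 b3] /=.
set s := _ * (b0 ^+ 2 + _ + _ + _).
have : a0 * b0 + a1 * b1 + a2 * b2 + a3 * b3 <= Num.sqrt s.
  apply: (le_trans (ler_norm _)); rewrite -sqrtr_sqr ler_sqrt.
    rewrite -subr_ge0.
    have -> : s - (a0 * b0 + a1 * b1 + a2 * b2 + a3 * b3) ^+ 2 =
      (a0 * b1 - a1 * b0) ^+ 2 + (a0 * b2 - a2 * b0) ^+ 2
      + (a0 * b3 - a3 * b0) ^+ 2 + (a1 * b2 - a2 * b1) ^+ 2
      + (a1 * b3 - a3 * b1) ^+ 2 + (a2 * b3 - a3 * b2) ^+ 2.
      by rewrite /s; ring.
    by rewrite !addr_ge0 ?sqr_ge0.
  by rewrite /s mulr_ge0 ?addr_ge0 ?sqr_ge0.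
by rewrite mulr2n; lra.
Qed.

End Scalars.

Section Norms.
Variables (R : realType) (F : scalar_kind) (k : nat).
Local Notation V := 'rV[scalar R F]_k.

Record is_norm (N : V -> R) : Prop := IsNorm {
  norm_ge0 : forall x, 0 <= N x;
  norm_eq0 : forall x, N x = 0 <-> x = 0;
  normZ : forall a x, N (a *: x) = scalar_abs a * N x;
  norm_triangle : forall x y, N (x + y) <= N x + N y }.

Record norm := Norm { norm_fun :> V -> R; normP : is_norm norm_fun }.

HB.instance Definition _ := gen_eqMixin norm.
HB.instance Definition _ := gen_choiceMixin norm.

Definition norm_equiv (N N' : norm) : bool :=
  `[< exists2 a : R, 0 < a & forall x, N' x = a * N x >].

Fact norm_equiv_refl : reflexive norm_equiv.
Proof. by move=> N; apply/asboolP; exists 1 => // x; rewrite mul1r. Qed.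

Fact norm_equiv_sym : symmetric norm_equiv.
Proof.
suff imp N N' : norm_equiv N N' -> norm_equiv N' N.
  by move=> N N'; apply/idP/idP; exact: imp.
move=> /asboolP[a a0 h]; apply/asboolP; exists a^-1; first by rewrite invr_gt0.
by move=> x; rewrite h mulKf// gt_eqF.
Qed.

Fact norm_equiv_trans : transitive norm_equiv.
Proof.
move=> N2 N1 N3 /asboolP[a a0 h] /asboolP[b b0 h']; apply/asboolP.
by exists (b * a) => [|x]; [rewrite mulr_gt0|rewrite h' h mulrA].
Qed.

Canonical norm_equiv_rel :=
  EquivRel norm_equiv norm_equiv_refl norm_equiv_sym norm_equiv_trans.

Definition norm_space := {eq_quot norm_equiv_rel}%qT.

Definition norm_class (N : norm) : norm_space := \pi_norm_space%qT N.

Definition norm_ratios (N N' : norm) : set R :=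
  [set N' x / N x | x in [set x : V | x != 0]].

Definition norm_dist (N N' : norm) : R :=
  ln (sup (norm_ratios N N')) - ln (inf (norm_ratios N N')).

(* The ratios of two norms are bounded, and bounded away from 0, because the
   dimension is finite. Replacing a representative by a positive multiple thus
   shifts both logarithms by the same amount, so the choice made by [repr] is
   immaterial. *)
Definition space_dist (c c' : norm_space) : R := norm_dist (repr c) (repr c').

(* The value at [-oo] is never used: [lp_norm] below requires [1 <= p]. *)
Definition lp_fun (p : \bar R) (x : V) : R :=
  match p with
  | r%:E => (\sum_(j < k) scalar_abs (x ord0 j) `^ r) `^ r^-1
  | _ => \big[Num.max/0]_(j < k) scalar_abs (x ord0 j)
  end.

Lemma powR_sum_ge0 (a : 'I_k -> R) r : 0 <= \sum_j a j `^ r.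
Proof. by apply: sumr_ge0 => j _; exact: powR_ge0. Qed.

Lemma finite_minkowski (r : R) (a b : 'I_k -> R) : 1 <= r ->
  (forall j, 0 <= a j) -> (forall j, 0 <= b j) ->
  (\sum_j (a j + b j) `^ r) `^ r^-1 <=
  (\sum_j a j `^ r) `^ r^-1 + (\sum_j b j `^ r) `^ r^-1.
Proof.
move=> r1 a0 b0; have r0 : 0 < r by exact: lt_le_trans r1.
have rV (x : R) : 0 <= x -> (x `^ r^-1) `^ r = x.
  by move=> x0; rewrite -powRrM mulVf ?gt_eqF// powRr1.
have powV (x : R) : 0 <= x -> (x `^ r) `^ r^-1 = x.
  by move=> x0; rewrite -powRrM mulfV ?gt_eqF// powRr1.
have null (c : 'I_k -> R) : (forall j, 0 <= c j) ->
    (\sum_j c j `^ r) `^ r^-1 = 0 -> forall j, c j = 0.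
  move=> c0 /powR_eq0_eq0 /eqP; rewrite psumr_eq0 => [|j _]; last first.
    exact: powR_ge0.
  by move=> /allP h j; have /eqP/powR_eq0_eq0 := h j (mem_index_enum j).
set S := (\sum_j a j `^ r) `^ r^-1; set T := (\sum_j b j `^ r) `^ r^-1.
have [S0|S0] := eqVneq S 0.
  rewrite S0 add0r /T; under eq_bigr => j _ do rewrite (null a a0 S0) add0r.
  exact: lexx.
have [T0|T0] := eqVneq T 0.
  rewrite T0 addr0 /S; under eq_bigr => j _ do rewrite (null b b0 T0) addr0.
  exact: lexx.
have {}S0 : 0 < S by rewrite lt_neqAle eq_sym S0 powR_ge0.
have {}T0 : 0 < T by rewrite lt_neqAle eq_sym T0 powR_ge0.
have SE : \sum_j a j `^ r = S `^ r by rewrite rV ?powR_sum_ge0.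
have TE : \sum_j b j `^ r = T `^ r by rewrite rV ?powR_sum_ge0.
clearbody S T; have ST : 0 < S + T by exact: addr_gt0.
have [[S1 T1] ST1] := (ltW S0, ltW T0, ltW ST).
have t0 : 0 <= S / (S + T) by rewrite divr_ge0.
have t1 : S / (S + T) <= 1 by rewrite ler_pdivrMr// mul1r lerDl ltW.
have conv j : (a j + b j) `^ r <= (S + T) `^ r *
    (S / (S + T) * (a j `^ r / S `^ r) + T / (S + T) * (b j `^ r / T `^ r)).
  have -> : a j + b j =
      (S + T) * (S / (S + T) * (a j / S) + T / (S + T) * (b j / T)).
    by field; rewrite !gt_eqF.
  rewrite powRM//; last by rewrite addr_ge0// mulr_ge0// divr_ge0.
  rewrite ler_pM2l ?powR_gt0//.
  have in0y (x y : R) : 0 <= x -> 0 <= y -> x / y \in `[0, +oo[%classic.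
    by move=> x0 y0; rewrite inE /= in_itv /= andbT divr_ge0.
  have := convex_powR r1 (Itv01 t0 t1) (in0y _ _ (a0 j) S1) (in0y _ _ (b0 j) T1).
  have divE (x y : R) : 0 <= x -> 0 < y -> (x / y) `^ r = x `^ r / y `^ r.
    move=> x0 y0; have y1 := ltW y0; rewrite powRM ?invr_ge0//; congr (_ * _).
    by rewrite -powR_inv1// powRAC powR_inv1 ?powR_ge0.
  rewrite [X in X `^ _ <= _]convRE [leRHS]convRE /= /unstable.onem -!divE//.
  by have -> : 1 - S / (S + T) = T / (S + T) by field; rewrite gt_eqF.
rewrite -[leRHS]powV//; rewrite ge0_ler_powR ?nnegrE ?invr_ge0 ?powR_sum_ge0 ?powR_ge0 ?(ltW r0)//.
apply: (le_trans (ler_sum _ (fun j _ => conv j))).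
rewrite -mulr_sumr big_split /= -!mulr_sumr -!mulr_suml.
rewrite SE TE !mulfV ?gt_eqF ?powR_gt0//.
by rewrite !mulr1 -mulrDl mulfV ?gt_eqF// mulr1.
Qed.

Lemma bigmax_abs_ge0 (x : V) : 0 <= \big[Num.max/0]_(j < k) scalar_abs (x ord0 j).
Proof. exact: bigmax_ge_id. Qed.

Fact lp_fun_is_norm (p : \bar R) : (1 <= p)%E -> is_norm (lp_fun p).
Proof.
case: p => [r|_|//]; last first.
  split=> /= [x|x|a x|x y].
  - exact: bigmax_abs_ge0.
  - split=> [x0|->]; last first.
      apply/eqP; rewrite eq_le bigmax_abs_ge0 andbT.
      by apply: bigmax_le => // j _; rewrite mxE abs0.
    apply/rowP => j; rewrite mxE; apply/abs_eq0/eqP.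
    by rewrite eq_le abs_ge0 andbT -x0; exact: le_bigmax.
  - apply: (big_rec2 (fun u v => u = scalar_abs a * v)) => [|j u v _ ->].
      by rewrite mulr0.
    by rewrite mxE absM maxr_pMr ?abs_ge0.
  - apply: bigmax_le => [|j _]; first by rewrite addr_ge0 ?bigmax_abs_ge0.
    rewrite mxE (le_trans (abs_triangle _ _))// lerD//.
      exact: (le_bigmax _ (fun i => scalar_abs (x ord0 i))).
    exact: (le_bigmax _ (fun i => scalar_abs (y ord0 i))).
rewrite lee_fin => r1; have r0 : 0 < r by exact: lt_le_trans r1.
split=> /= [x|x|a x|x y].
- exact: powR_ge0.
- split=> [/powR_eq0_eq0/eqP|->].
    rewrite psumr_eq0 => [/allP h|j _]; last exact: powR_ge0.
    apply/rowP => j; rewrite mxE; apply: abs_eq0.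
    by have /eqP/powR_eq0_eq0 := h j (mem_index_enum j).
  rewrite big1 ?powR0// ?invr_eq0 ?gt_eqF// => j _.
  by rewrite mxE abs0 powR0// gt_eqF.
- under eq_bigr => j _ do rewrite mxE absM powRM ?abs_ge0//.
  rewrite -mulr_sumr powRM ?powR_ge0 ?powR_sum_ge0//.
  by rewrite -powRrM mulfV ?gt_eqF// powRr1 ?abs_ge0.
- apply: le_trans (finite_minkowski r1 _ _); try by move=> j; exact: abs_ge0.
  apply: ge0_ler_powR.
  + by rewrite invr_ge0 ltW.
  + exact: powR_sum_ge0.
  + exact: powR_sum_ge0.
  apply: ler_sum => j _.
  rewrite ge0_ler_powR ?nnegrE ?addr_ge0 ?abs_ge0 ?(ltW r0)//.
  by rewrite mxE abs_triangle.
Qed.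

Definition lp_norm (p : \bar R) (p1 : (1 <= p)%E) : norm :=
  Norm (lp_fun_is_norm p1).

Definition lp_space : set norm_space :=
  [set c | exists (p : \bar R) (p1 : (1 <= p)%E), c = norm_class (lp_norm p1)].

End Norms.

Arguments lp_space : clear implicits.

(* Main.v *)
Require Import Defs.
From mathcomp Require Import all_boot all_order all_algebra.
From mathcomp Require Import generic_quotient ring lra.
From mathcomp Require Import all_classical all_reals all_analysis.

Set Implicit Arguments.
Unset Strict Implicit.
Unset Printing Implicit Defensive.

Import Order.TTheory GRing.Theory Num.Theory.

Local Open Scope classical_set_scope.
Local Open Scope ring_scope.

(** Let [e] be a basis vector and let [ones] be the vector all of whose entries
    are 1. For [p <= q] the ratio of the q-norm to the p-norm is largest at [e]
    (the p-norms decrease with p) and smallest at [ones] (the power means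
    increase with p). These two inequalities are [lp_fun_le] and [lp_fun_ge];
    for finite [q] both are inequalities between sums of s-th powers, with
    [s = q / p >= 1], namely [sum_powR_le] and [powR_sum_le].

    So one pair of vectors serves as the extremal pair for all the norms of the
    family at once. This alone gives the isometry: if [M / N] is maximal at [e]
    and minimal at [ones], then the distance between the classes of [N] and [M]
    is [ln (M e / N e) - ln (M ones / N ones)], and regrouping the four terms
    writes it as the difference of the values at [N] and [M] of
    [ln (N ones / N e)], the [log_spread] of a norm. The log-spread is unchanged
    when the norm is rescaled, so it descends to equivalence classes; on the
    p-norm it is [ln k / p], and on the sup norm it is 0. Hence it is the
    required map.

    Injectivity is the equality case: if the log-spreads of [N] and [M] agree,
    the largest and the smallest value of [M / N] coincide, so [M] is a multiple
    of [N]. Surjectivity is solving [ln k / p = t] for [p]. *)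

(** * Power sums *)

Section PowerSums.
Variables (R : realType) (I : finType).
Implicit Types (s t : R) (b : I -> R).

(** Bernoulli's inequality: a convex power lies above its tangent line at 1.
    For [s > 1] it is Young's inequality for the conjugate exponents [s] and
    [s / (s - 1)], applied to the product [t * 1]. *)
Lemma powR_bernoulli s t : 1 <= s -> 0 <= t -> 1 + s * (t - 1) <= t `^ s.
Proof.
rewrite le_eqVlt => /predU1P[<- t0|s1 t0].
  by rewrite powRr1// mul1r addrC subrK.
have s0 : 0 < s by exact: lt_trans s1.
have s10 : 0 < s - 1 by rewrite subr_gt0.
have /= := @conjugate_powR R t 1 s (s / (s - 1)) t0 ler01 s0 (divr_gt0 s0 s10).
rewrite mulr1 powR1 => young.
have {young}: t <= t `^ s / s + 1 / (s / (s - 1)).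
  by apply: young; field; rewrite !gt_eqF.
rewrite -(ler_pM2l s0).
have -> : s * (t `^ s / s + 1 / (s / (s - 1))) = t `^ s + (s - 1).
  by field; rewrite !gt_eqF.
lra.
Qed.

(** Each term is at most the whole sum, so
    [b i `^ s = b i * b i `^ (s - 1)] is at most [b i] times the power [s - 1]
    of the sum. *)
Lemma sum_powR_le s b : 1 <= s -> (forall i, 0 <= b i) ->
  \sum_i b i `^ s <= (\sum_i b i) `^ s.
Proof.
move=> s1 b0; have s0 : 0 < s by exact: lt_le_trans s1.
rewrite -(mulr_powRB1 (sumr_ge0 _ (fun i _ => b0 i)) s0) mulr_suml.
apply: ler_sum => i _; rewrite -mulr_powRB1// ler_wpM2l//.
rewrite ge0_ler_powR ?nnegrE ?subr_ge0 ?sumr_ge0//.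
by rewrite (bigD1 i)//= lerDl sumr_ge0.
Qed.

(** The power mean inequality. Bernoulli's inequality at the ratios of the [b i]
    to their mean [m] bounds each [b i `^ s] below by an affine function of
    [b i]; the linear parts cancel on summing, because the [b i - m] add up to
    0. *)
Lemma powR_sum_le s b : 1 <= s -> (forall i, 0 <= b i) ->
  (\sum_i b i) `^ s <= #|I|%:R `^ (s - 1) * \sum_i b i `^ s.
Proof.
move=> s1 b0; have s0 : 0 < s by exact: lt_le_trans s1.
have sum0 : 0 <= \sum_i b i by exact: sumr_ge0.
have [->|sum_neq0] := eqVneq (\sum_i b i) 0.
  by rewrite powR0 ?gt_eqF// mulr_ge0 ?powR_ge0 ?sumr_ge0// => i _; exact: powR_ge0.
have {sum_neq0}sum_gt0 : 0 < \sum_i b i by rewrite lt_neqAle eq_sym sum_neq0.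
have n0 : 0 < #|I|%:R :> R.
  rewrite ltr0n lt0n; apply: contraTneq sum_gt0 => /card0_eq I0.
  by rewrite big1 ?ltxx// => i; have := I0 i.
set n : R := #|I|%:R in n0 *; pose m := (\sum_i b i) / n.
have m0 : 0 < m by exact: divr_gt0.
have mn : m * n = \sum_i b i by rewrite divfK ?gt_eqF.
clearbody m.
have tangent i : m `^ s * (1 + s * (b i / m - 1)) <= b i `^ s.
  rewrite -[X in _ <= X `^ _](divfK (lt0r_neq0 m0)) [_ / m * m]mulrC.
  rewrite powRM ?divr_ge0// ?(ltW m0)// ler_wpM2l ?powR_ge0//.
  by rewrite powR_bernoulli// divr_ge0// ltW.
have -> : (\sum_i b i) `^ s = n `^ (s - 1) * (m `^ s * n).
  by rewrite mulrCA [_ * n]mulrC mulr_powRB1 ?ltW// -powRM ?ltW// mn.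
rewrite ler_wpM2l ?powR_ge0//.
apply: le_trans (ler_sum _ (fun i _ => tangent i)).
rewrite -mulr_sumr ler_wpM2l ?powR_ge0//.
rewrite big_split/= -mulr_sumr sumrB -mulr_suml !sumr_const -/n -mn.
by rewrite mulrAC mulfV ?gt_eqF// mul1r subrr mulr0 addr0.
Qed.

End PowerSums.

(** * Pairs of norms with given extremal vectors *)

Section Flattening.
Variables (R : realType) (F : scalar_kind) (k : nat).
Local Notation V := 'rV[Defs.scalar R F]_k.
Implicit Types (N M : norm R F k) (u v x : V).

Lemma norm_gt0 N x : x != 0 -> 0 < N x.
Proof.
move=> x0; rewrite lt_neqAle (norm_ge0 (normP N)) andbT eq_sym.
by apply: contraNneq x0 => /(norm_eq0 (normP N)) ->.
Qed.

(** The ratio [M / N] is largest at [u] and smallest at [v]. Cross-multiplying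
    includes the vector 0 and makes the relation visibly invariant under
    rescaling either norm. *)
Definition flattens u v N M := forall x,
  M x * N u <= M u * N x /\ M v * N x <= M x * N v.

Definition log_spread u v N : R := ln (N v / N u).

(** The supremum and the infimum in the distance are attained, at [u] and [v]. *)
Lemma norm_dist_extremal u v N M : u != 0 -> v != 0 ->
  (forall x, M x * N u <= M u * N x) -> (forall x, M v * N x <= M x * N v) ->
  norm_dist N M = ln (M u / N u) - ln (M v / N v).
Proof.
move=> u0 v0 max_u min_v.
have ratio x : x != 0 -> norm_ratios N M (M x / N x) by move=> x0; exists x.
have ub : ubound (norm_ratios N M) (M u / N u).
  move=> _ [x x0 <-]; rewrite ler_pdivrMr ?norm_gt0// mulrAC.
  by rewrite ler_pdivlMr ?norm_gt0.
have lb : lbound (norm_ratios N M) (M v / N v).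
  move=> _ [x x0 <-]; rewrite ler_pdivrMr ?norm_gt0// mulrAC.
  by rewrite ler_pdivlMr ?norm_gt0.
congr (ln _ - ln _); apply/eqP; rewrite eq_le.
  rewrite ge_sup//=; last by exists (M u / N u); exact: ratio.
  by rewrite ub_le_sup//; [exists (M u / N u)|exact: ratio].
rewrite ge_inf//=; last 2 first.
- by exists (M v / N v).
- exact: ratio.
by rewrite lb_le_inf//; exists (M v / N v); exact: ratio.
Qed.

Section ExtremalPair.
Variables (u v : V).
Hypotheses (u0 : u != 0) (v0 : v != 0).
Local Notation flattens := (flattens u v).
Local Notation log_spread := (log_spread u v).

Lemma norm_dist_flattens N M : flattens N M ->
  norm_dist N M = log_spread N - log_spread M.
Proof.
move=> flat; rewrite (norm_dist_extremal u0 v0) => [|x|x]; try by case: (flat x).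
by rewrite /log_spread !ln_div ?posrE ?norm_gt0//; ring.
Qed.

(** Inverting the ratio exchanges the roles of [u] and [v]. *)
Lemma norm_dist_flattens_sym N M : flattens N M ->
  norm_dist M N = log_spread N - log_spread M.
Proof.
move=> flat; rewrite (norm_dist_extremal v0 u0) => [|x|x]; last 2 first.
- by rewrite mulrC [leRHS]mulrC; case: (flat x).
- by rewrite mulrC [leRHS]mulrC; case: (flat x).
by rewrite /log_spread !ln_div ?posrE ?norm_gt0//; ring.
Qed.

Lemma log_spread_ge N M : flattens N M -> log_spread M <= log_spread N.
Proof.
move=> flat; rewrite ler_ln ?posrE ?divr_gt0 ?norm_gt0//.
rewrite ler_pdivrMr ?norm_gt0// mulrAC ler_pdivlMr ?norm_gt0//.
by rewrite [leRHS]mulrC; case: (flat v).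
Qed.

Lemma flattens_dist N M : flattens N M \/ flattens M N ->
  `|log_spread N - log_spread M| = norm_dist N M.
Proof.
case=> flat; have le := log_spread_ge flat.
  by rewrite norm_dist_flattens// ger0_norm// subr_ge0.
by rewrite norm_dist_flattens_sym// distrC ger0_norm// subr_ge0.
Qed.

(** Equal log-spreads mean that the maximum and the minimum of [M / N] are the
    same number, which is then the scaling factor. *)
Lemma flattens_equiv N M : flattens N M -> log_spread N = log_spread M ->
  norm_equiv N M.
Proof.
move=> flat /ln_inj; rewrite !posrE !divr_gt0 ?norm_gt0// => /(_ isT isT) spread.
have {spread} : M v / N v = M u / N u.
  apply/eqP; rewrite eqr_div ?lt0r_neq0 ?norm_gt0//.
  move/eqP: spread; rewrite eqr_div ?lt0r_neq0 ?norm_gt0// => /eqP spread.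
  by rewrite -spread mulrC.
move=> ratio; apply/asboolP; exists (M u / N u); first by rewrite divr_gt0 ?norm_gt0.
move=> x; have [max_u min_v] := flat x; apply/eqP; rewrite eq_le; apply/andP; split.
  by rewrite mulrAC ler_pdivlMr ?norm_gt0.
by rewrite -ratio mulrAC ler_pdivrMr ?norm_gt0.
Qed.

Lemma log_spread_equiv N M : norm_equiv N M -> log_spread N = log_spread M.
Proof.
move=> /asboolP[a a0 MN]; rewrite /log_spread !MN; congr ln.
by rewrite -mulf_div mulfV ?gt_eqF// mul1r.
Qed.

Lemma flattens_congr N N' M M' : norm_equiv N N' -> norm_equiv M M' ->
  flattens N M -> flattens N' M'.
Proof.
move=> /asboolP[a a0 N'E] /asboolP[b b0 M'E] flat x; rewrite !N'E !M'E.
have pull m n : b * m * (a * n) = b * a * (m * n) by exact: mulrACA.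
by rewrite !pull !ler_pM2l ?mulr_gt0//; exact: flat.
Qed.

End ExtremalPair.
End Flattening.

(** * Comparison of the p-norms *)

Section LpNorms.
Variables (R : realType) (F : scalar_kind) (k : nat).
Local Notation V := 'rV[Defs.scalar R F]_k.
Implicit Types (p q : \bar R) (x : V).

Let ones : V := const_mx 1.

Lemma abs1 : scalar_abs (1 : Defs.scalar R F) = 1.
Proof. by rewrite absE; case: F => /=; rewrite !expr0n expr1n/= !addr0 sqrtr1. Qed.

Lemma lp_fun_basis p (j0 : 'I_k) : (1 <= p)%E ->
  lp_fun p (delta_mx 0 j0 : V) = 1.
Proof.
case: p => [r|_|//] /=.
  rewrite lee_fin => r1; have r0 : r != 0 by rewrite gt_eqF// (lt_le_trans _ r1).
  rewrite (bigD1 j0)//= big1 => [|j jj0]; last by rewrite mxE (negPf jj0) abs0 powR0.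
  by rewrite mxE !eqxx abs1 addr0 !powR1.
apply/eqP; rewrite eq_le; apply/andP; split.
  by apply: bigmax_le => // j _; rewrite mxE eqxx/=; case: eqP => _; rewrite ?abs1 ?abs0.
have := le_bigmax 0 (fun j => scalar_abs ((delta_mx 0 j0 : V) ord0 j)) j0.
by rewrite [X in X <= _]/= mxE !eqxx abs1.
Qed.

Lemma lp_fun_ones r : lp_fun r%:E ones = k%:R `^ r^-1.
Proof.
rewrite /=; under eq_bigr => j _ do rewrite mxE abs1 powR1.
by rewrite sumr_const card_ord.
Qed.

Lemma lp_fun_ones_oo (k1 : (1 <= k)%N) : lp_fun +oo%E ones = 1.
Proof.
apply/eqP; rewrite eq_le; apply/andP; split.
  by apply: bigmax_le => // j _; rewrite mxE abs1.
have := le_bigmax 0 (fun j => scalar_abs (ones ord0 j)) (Ordinal k1).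
by rewrite mxE abs1.
Qed.

(** For finite exponents, take s-th roots in [sum_powR_le], applied with the
    exponent [s / r] to the r-th powers of the absolute values; when [q] is
    infinite, each entry is dominated by the sum. *)
Lemma lp_fun_le p q x : (1 <= p)%E -> (p <= q)%E -> lp_fun q x <= lp_fun p x.
Proof.
case: p => [r|_|//]; last by rewrite leye_eq => /eqP ->.
case: q => [s||] r1 rs; last by exfalso.
all: rewrite lee_fin in r1.
- rewrite lee_fin in rs; have r0 : 0 < r by exact: lt_le_trans r1.
  have s0 : 0 < s by exact: lt_le_trans rs.
  have sr1 : 1 <= s / r by rewrite ler_pdivlMr// mul1r.
  have := sum_powR_le sr1 (fun j => powR_ge0 (scalar_abs (x ord0 j)) r).
  under eq_bigr => j _ do rewrite -powRrM mulrC divfK ?gt_eqF//.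
  move=> le_sums; rewrite /= -[r^-1](mulfK (lt0r_neq0 s0)) [r^-1 * s]mulrC powRrM.
  by rewrite ge0_ler_powR ?nnegrE ?powR_ge0 ?powR_sum_ge0 ?invr_ge0 ?(ltW s0).
- rewrite /=; have r0 : 0 < r by exact: lt_le_trans r1.
  apply: bigmax_le => [|j _]; first exact: powR_ge0.
  rewrite -[leLHS](powRr1 (abs_ge0 _)) -(mulfV (lt0r_neq0 r0)) powRrM.
  rewrite ge0_ler_powR ?nnegrE ?powR_ge0 ?powR_sum_ge0 ?invr_ge0 ?(ltW r0)//.
  by rewrite (bigD1 j)//= lerDl sumr_ge0// => i _; exact: powR_ge0.
Qed.

(** The power means increase with the exponent: for finite exponents this is
    [powR_sum_le] with the exponent [s / r]; when [q] is infinite, each entry is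
    bounded by the maximum. The value of each norm at [ones] is the
    normalisation that turns it into a mean. *)
Lemma lp_fun_ge p q x : (1 <= k)%N -> (1 <= p)%E -> (p <= q)%E ->
  lp_fun q ones * lp_fun p x <= lp_fun q x * lp_fun p ones.
Proof.
move=> k1; case: p => [r|_|//]; last by rewrite leye_eq => /eqP ->; rewrite mulrC.
case: q => [s||] r1 rs; last by exfalso.
all: rewrite lee_fin in r1.
- rewrite lee_fin in rs; have r0 : 0 < r by exact: lt_le_trans r1.
  have s0 : 0 < s by exact: lt_le_trans rs.
  have sr1 : 1 <= s / r by rewrite ler_pdivlMr// mul1r.
  have := powR_sum_le sr1 (fun j => powR_ge0 (scalar_abs (x ord0 j)) r).
  under [X in _ <= _ * X]eq_bigr => j _ do rewrite -powRrM mulrC divfK ?gt_eqF//.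
  rewrite card_ord => le_sums.
  have {le_sums}le_roots : lp_fun r%:E x <= k%:R `^ (r^-1 - s^-1) * lp_fun s%:E x.
    rewrite /= -{1}[r^-1](mulfK (lt0r_neq0 s0)) [r^-1 * s]mulrC powRrM.
    have -> : r^-1 - s^-1 = (s / r - 1) / s by field; rewrite !gt_eqF.
    rewrite powRrM -powRM ?powR_ge0 ?powR_sum_ge0//.
    rewrite ge0_ler_powR ?nnegrE ?mulr_ge0 ?powR_ge0 ?powR_sum_ge0//.
    by rewrite invr_ge0 ltW.
  rewrite !lp_fun_ones [leRHS]mulrC.
  apply: (le_trans (ler_wpM2l (powR_ge0 _ _) le_roots)).
  by rewrite mulrA -powRD addrC subrK// invr_eq0 gt_eqF.
- have r0 : 0 < r by exact: lt_le_trans r1.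
  rewrite (lp_fun_ones_oo k1) mul1r lp_fun_ones [lp_fun +oo%E x]/=.
  set m := \big[_/_]_(_ < _) _.
  have m0 : 0 <= m by exact: bigmax_abs_ge0.
  have -> : m = (m `^ r) `^ r^-1 by rewrite -powRrM mulfV ?gt_eqF// powRr1.
  rewrite -powRM ?powR_ge0//.
  rewrite ge0_ler_powR ?nnegrE ?mulr_ge0 ?powR_ge0 ?powR_sum_ge0 ?invr_ge0 ?(ltW r0)//.
  rewrite mulr_natr -[X in _ *+ X](card_ord k) -sumr_const; apply: ler_sum => j _.
  rewrite ge0_ler_powR ?nnegrE ?abs_ge0 ?(ltW r0)//.
  exact: (le_bigmax _ (fun i => scalar_abs (x ord0 i))).
Qed.

Lemma lp_flattens p q (p1 : (1 <= p)%E) (q1 : (1 <= q)%E) (j0 : 'I_k) :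
  (p <= q)%E -> flattens (delta_mx 0 j0) ones (lp_norm F k p1) (lp_norm F k q1).
Proof.
move=> pq x; split; rewrite /= ?lp_fun_basis// ?mulr1 ?mul1r; first exact: lp_fun_le.
exact: lp_fun_ge (leq_ltn_trans (leq0n j0) (ltn_ord j0)) _ _.
Qed.

Lemma log_spread_lp r (r1 : (1 <= r%:E)%E) (j0 : 'I_k) :
  log_spread (delta_mx 0 j0) ones (lp_norm F k r1) = ln k%:R / r.
Proof.
rewrite /log_spread [norm_fun _ (delta_mx _ _)](lp_fun_basis j0 r1) divr1.
by rewrite [norm_fun _ _]lp_fun_ones ln_powR mulrC.
Qed.

Lemma log_spread_lp_oo (j0 : 'I_k) :
  log_spread (delta_mx 0 j0) ones (lp_norm F k (leey 1)) = 0.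
Proof.
have k1 : (1 <= k)%N := leq_ltn_trans (leq0n j0) (ltn_ord j0).
rewrite /log_spread [norm_fun _ (delta_mx _ _)](lp_fun_basis j0 (leey 1)).
by rewrite [norm_fun _ _](lp_fun_ones_oo k1) divr1 ln1.
Qed.

End LpNorms.

(** * Equivalence classes *)

Section Classes.
Variables (R : realType) (F : scalar_kind) (k : nat).
Implicit Types (N M : norm R F k) (c : norm_space R F k).

Lemma norm_class_eq N M : norm_equiv N M -> norm_class N = norm_class M.
Proof. by move=> NM; apply/(@eqmodP _ (norm_equiv_rel R F k)). Qed.

Lemma norm_class_repr c : norm_class (repr c) = c.
Proof. exact: reprK. Qed.

Lemma norm_equiv_repr N : norm_equiv N (repr (norm_class N)).
Proof.
by apply/(@eqmodP _ (norm_equiv_rel R F k)); rewrite [RHS]norm_class_repr.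
Qed.

(** The exponents are totally ordered, and the relation does not depend on the
    representatives, so it holds in one direction or the other. *)
Lemma lp_space_comparable c c' (j0 : 'I_k) :
    lp_space R F k c -> lp_space R F k c' ->
  let flat := flattens (delta_mx 0 j0) (const_mx 1) in
  flat (repr c) (repr c') \/ flat (repr c') (repr c).
Proof.
move=> [p [p1 ->]] [q [q1 ->]] /=.
case: (leP p q) => [pq|/ltW qp]; [left|right];
  by apply: flattens_congr (norm_equiv_repr _) (norm_equiv_repr _) _; exact: lp_flattens.
Qed.

End Classes.

Theorem proposition3p2 (R : realType) (F : scalar_kind) (k : nat)
    (k1 : (1 <= k)%N) :
  exists f : norm_space R F k -> R,
    [/\ forall (p : R) (p1 : (1 <= p%:E)%E),
          f (norm_class (lp_norm F k p1)) = ln k%:R / p,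
        f (norm_class (lp_norm F k (leey 1))) = 0,
        set_bij (lp_space R F k) `[0, ln k%:R] f
      & forall c c' : norm_space R F k,
          lp_space R F k c -> lp_space R F k c' ->
          `|f c - f c'| = space_dist c c'].
Proof.
pose j0 : 'I_k := Ordinal k1.
pose e : 'rV[Defs.scalar R F]_k := delta_mx 0 j0.
pose ones : 'rV[Defs.scalar R F]_k := const_mx 1.
have e0 : e != 0.
  by apply/eqP => /rowP/(_ j0)/eqP; rewrite !mxE !eqxx oner_eq0.
have ones0 : ones != 0.
  by apply/eqP => /rowP/(_ j0)/eqP; rewrite !mxE oner_eq0.
pose f (c : norm_space R F k) := log_spread e ones (repr c).
have fE N : f (norm_class N) = log_spread e ones N.
  by rewrite /f -(log_spread_equiv e ones (norm_equiv_repr N)).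
have f_lp p (p1 : (1 <= p%:E)%E) : f (norm_class (lp_norm F k p1)) = ln k%:R / p.
  by rewrite fE log_spread_lp.
have f_oo : f (norm_class (lp_norm F k (leey 1))) = 0.
  by rewrite fE log_spread_lp_oo.
have lnk0 : 0 <= ln (k%:R : R) by rewrite ln_ge0// ler1n.
exists f; split=> //; last first.
  by move=> c c' lpc lpc'; apply: flattens_dist => //; exact: lp_space_comparable.
split.
- move=> _ [[r||] [p1 ->]] //=; rewrite in_itv/=; last first.
    by rewrite (bool_irrelevance p1 (leey 1)) f_oo lexx lnk0.
  have r1 : 1 <= r by rewrite -lee_fin.
  have r0 : 0 < r by exact: lt_le_trans r1.
  by rewrite f_lp divr_ge0 ?(ltW r0)//= ler_pdivrMr// ler_peMr.
- move=> c c'; rewrite !inE => lpc lpc' fcc'.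
  rewrite -(norm_class_repr c) -(norm_class_repr c').
  have [flat|flat] := lp_space_comparable j0 lpc lpc'.
    by apply: norm_class_eq; exact: flattens_equiv flat fcc'.
  by apply/esym/norm_class_eq; exact: flattens_equiv flat (esym fcc').
- move=> t /=; rewrite in_itv/= => /andP[]; rewrite le_eqVlt => /predU1P[<- _|t0 tk].
    by exists (norm_class (lp_norm F k (leey 1))) => //; exists +oo%E, (leey 1).
  (* Solving [ln k / p = t]; the bound [t <= ln k] makes [p] at least 1. *)
  have p1 : (1 <= (ln k%:R / t)%:E)%E by rewrite lee_fin ler_pdivlMr// mul1r.
  exists (norm_class (lp_norm F k p1)); first by exists (ln k%:R / t)%:E, p1.
  by rewrite f_lp; field; rewrite !gt_eqF// (lt_le_trans t0 tk).
Qed.
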